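(* Let $X$ be a separable metric space equipped with a locally finite measure $\mu$ on its Borel $\sigma$-algebra $\mathcal{B}(X)$ that has support $X$. Let $N\in\mathbb{N}$ and let $K:X\times X\to\mathbb{R}^{N\times N}$ be a bounded and continuous kernel satisfying $K(x,y)=K(y,x)^\top$ for all $x,y\in X$. Then the following statements are equivalent: (i) $K$ is positive definite, i.e., $$\sum_{i,j=1}^n c_i^\top K(x_i,x_j)c_j\geq 0,\quad\text{for any } n\in\mathbb{N},\ x_1,\dots,x_n\in X,\ c_1,\dots,c_n\in\mathbb{R}^N.$$ (ii) $K$ is integrally positive definite with respect to $C(X,\mathbb{R}^N)\cap L^1(X,\mathbb{R}^N)$, i.e., $$\int_X\int_X f(x)^\top K(x,y)f(y)\,d\mu(x)\,d\mu(y)\geq 0,\quad\text{for all } f\in C(X,\mathbb{R}^N)\cap L^1(X,\mathbb{R}^N).$$ (iii) $K$ is integrally positive definite with respect to $L^1(X,\mathbb{R}^N)$, i.e., $$\int_X\int_X f(x)^\top K(x,y)f(y)\,d\mu(x)\,d\mu(y)\geq 0,\quad\text{for all } f\in L^1(X,\mathbb{R}^N).$$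
   Context: $\mathbb{N}=\{1,2,\dots\}$. A kernel on $X$ is simply a function $K:X\times X\to\mathbb{R}^{N\times N}$; it is bounded if $\sup_{x,y\in X}\|K(x,y)\|<\infty$, where $\|\cdot\|$ is the Frobenius norm (any matrix norm gives the same notion), and continuous means jointly continuous on $X\times X$. The measure $\mu$ (nonnegative) is locally finite if every $x\in X$ has an open neighborhood $U_x$ with $\mu(U_x)<\infty$; it has support $X$ if every nonempty open subset of $X$ has strictly positive measure. $C(X,\mathbb{R}^N)$ denotes the continuous functions $X\to\mathbb{R}^N$, and $L^1(X,\mathbb{R}^N)$ the $\mu$-integrable functions $X\to\mathbb{R}^N$. *)

(* Defs.v *)
From HB Require Import structures.
From mathcomp Require Import all_boot all_order all_algebra.
From mathcomp Require Import all_classical all_reals all_analysis.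

Set Implicit Arguments.
Unset Strict Implicit.
Unset Printing Implicit Defensive.

Import Order.TTheory GRing.Theory Num.Theory.
Import numFieldNormedType.Exports.

Local Open Scope classical_set_scope.
Local Open Scope ring_scope.

(* [measurableType] requires a point, which [metricType] does not provide. *)
#[short(type="pmetricType")]
HB.structure Definition PMetric (K : numDomainType) :=
  { M of Metric K M & Pointed M }.

Notation borelType T := (g_sigma_algebraType (@open T)).

Definition separable_space (T : topologicalType) :=
  exists2 D : set T, countable D & dense D.

Section borel_measures.
Context {R : realType} {X : ptopologicalType}.
Variable mu : {measure set (borelType X) -> \bar R}.

Definition locally_finite :=
  forall x : X, exists2 U : set X, open_nbhs x U & (mu U < +oo)%E.

Definition full_support :=
  forall U : set X, open U -> U !=set0 -> (0 < mu U)%E.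

(* Integrability of an R^N-valued function is that of its coordinates. *)
Definition L1 (N : nat) : set (X -> 'cV[R]_N) :=
  [set f : X -> 'cV[R]_N | forall i,
     mu.-integrable [set: borelType X] (fun x => (f x i ord0)%:E)].

End borel_measures.
Arguments L1 {R X} mu N.

Section kernels.
Context {R : realType} {N : nat}.

Definition frobenius_norm (A : 'M[R]_N) : R :=
  Num.sqrt (\sum_i \sum_j A i j ^+ 2).

Definition bilinear_form (A : 'M[R]_N) (u v : 'cV[R]_N) : R :=
  (u^T *m A *m v) ord0 ord0.

Definition bounded_kernel (X : Type) (K : X -> X -> 'M[R]_N) :=
  has_ubound (range (fun z : X * X => frobenius_norm (K z.1 z.2))).

Definition continuous_kernel (X : topologicalType) (K : X -> X -> 'M[R]_N) :=
  continuous (fun z : X * X => K z.1 z.2).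

Definition positive_definite (X : Type) (K : X -> X -> 'M[R]_N) :=
  forall (n : nat) (x : 'I_n -> X) (c : 'I_n -> 'cV[R]_N), (0 < n)%N ->
    0 <= \sum_(i < n) \sum_(j < n) bilinear_form (K (x i) (x j)) (c i) (c j).

Definition integrally_positive_definite (X : ptopologicalType)
    (mu : {measure set (borelType X) -> \bar R}) (K : X -> X -> 'M[R]_N)
    (F : set (X -> 'cV[R]_N)) :=
  forall f, F f ->
    (0 <= \int[mu]_y \int[mu]_x (bilinear_form (K x y) (f x) (f y))%:E)%E.

End kernels.

(* Main.v *)
Require Import Defs.
From mathcomp Require Import all_boot all_order all_algebra.
From mathcomp Require Import all_classical all_reals all_analysis.
From mathcomp Require Import measurable_realfun.
From mathcomp Require Import lra.

(** (i) => (iii): for a dense sequence [s], let [pi_m x] be a point of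
    [s_0, ..., s_m] nearest to [x]. Then [pi_m x] tends to [x], so by dominated
    convergence, applied once in each variable, the double integral of
    [f(x)^T K(x,y) f(y)] is the limit of the integrals with [K(pi_m x, pi_m y)]
    in place of [K(x,y)]. As [pi_m] takes finitely many values, the latter are
    sums [sum_(k,l) c_k^T K(s_k,s_l) c_l] with [c_k] the integral of [f] over
    the set where [pi_m] is [s_k]. Only iterated integrals occur, so that no
    product measure (nor sigma-finiteness) is involved.

    (ii) => (i): test against [f = sum_i psi_i c_i], where [psi_i] is a
    continuous bump of integral 1 supported in a small ball around [x_i]. *)

Set Implicit Arguments.
Unset Strict Implicit.
Unset Printing Implicit Defensive.

Import Order.TTheory GRing.Theory Num.Theory.
Import numFieldNormedType.Exports.

Local Open Scope classical_set_scope.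
Local Open Scope ring_scope.

(** * Coordinates and bounds for the form [u^T A v] *)

Section bilinear_form.
Context {R : realType} {N : nat}.
Implicit Types (A : 'M[R]_N) (u v : 'cV[R]_N).

Lemma bilinear_formE A u v :
  bilinear_form A u v =
    \sum_(a < N) \sum_(b < N) A a b * u a ord0 * v b ord0.
Proof.
rewrite /bilinear_form mxE exchange_big /=; apply: eq_bigr => b _.
rewrite mxE big_distrl /=; apply: eq_bigr => a _.
by rewrite mxE [u a _ * _]mulrC.
Qed.

Lemma le_entry_frobenius A a b : `|A a b| <= frobenius_norm A.
Proof.
rewrite /frobenius_norm -sqrtr_sqr ler_wsqrtr// (bigD1 a)//= (bigD1 b)//=.
rewrite -addrA lerDl addr_ge0// sumr_ge0// => *; first exact: sqr_ge0.
by rewrite sumr_ge0// => *; exact: sqr_ge0.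
Qed.

(** The bound separates [u] from [v]: applied to [f x] and [f y], it gives a majorant
    [C * F x * F y], where [F] sums the absolute values of the coordinates of [f]. *)
Lemma le_bilinear_form A u v C : frobenius_norm A <= C ->
  `|bilinear_form A u v| <=
    C * (\sum_a `|u a ord0|) * (\sum_b `|v b ord0|).
Proof.
move=> AC; rewrite bilinear_formE (le_trans (ler_norm_sum _ _ _))//.
rewrite -mulrA mulr_suml mulr_sumr ler_sum// => a _.
rewrite mulrA mulr_sumr (le_trans (ler_norm_sum _ _ _))// ler_sum// => b _.
rewrite !normrM ler_wpM2r// ler_wpM2r//.
exact: le_trans (le_entry_frobenius A a b) AC.
Qed.

Lemma bilinear_form_sum (I J : finType) (A : 'M[R]_N) (a : I -> R) (b : J -> R)
    (u : I -> 'cV[R]_N) (v : J -> 'cV[R]_N) :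
  bilinear_form A (\sum_i a i *: u i) (\sum_j b j *: v j) =
    \sum_i \sum_j bilinear_form A (u i) (v j) * a i * b j.
Proof.
rewrite /bilinear_form (raddf_sum trmx) /= !mulmx_suml summxE; apply: eq_bigr => i _.
rewrite mulmx_sumr summxE; apply: eq_bigr => j _.
have -> : (a i *: u i)^T = a i *: (u i)^T by apply/matrixP => k l; rewrite !mxE.
by rewrite -!scalemxAl -scalemxAr !scalerA mxE mulrC mulrA.
Qed.

End bilinear_form.

(** * Iterated integrals: separated finite sums and dominated convergence *)

Section iterated_integrals.
Context d (T : measurableType d) (R : realType).
Variable mu : {measure set T -> \bar R}.

Lemma integrable_lincomb (P : finType) (a : P -> R) (u : P -> T -> R) :
  (forall p, mu.-integrable setT (EFin \o u p)) ->
  mu.-integrable setT (EFin \o (fun x => \sum_p a p * u p x)).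
Proof.
move=> iu; apply: (@eq_integrable _ _ _ _ _ _
    (fun x => \sum_p (a p)%:E * (u p x)%:E)%E) => //.
  by move=> x _ /=; rewrite -sumEFin.
by apply: integrable_sum => // p _; exact: (integrableZl measurableT (a p) (iu p)).
Qed.

Lemma integral_lincomb (P : finType) (a : P -> R) (u : P -> T -> R) :
  (forall p, mu.-integrable setT (EFin \o u p)) ->
  (\int[mu]_x (\sum_p a p * u p x)%:E =
    (\sum_p a p * \int[mu]_x u p x)%:E)%E.
Proof.
move=> iu; under eq_integral do rewrite -sumEFin.
rewrite integral_sum//=; last first.
  by move=> p; exact: (integrableZl measurableT (a p) (iu p)).
rewrite -sumEFin; apply: eq_bigr => p _; rewrite EFinM.
have -> : (\int[mu]_x u p x)%:E = (\int[mu]_x (u p x)%:E)%E.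
  by rewrite /Rintegral fineK//; exact: integrable_fin_num (iu p).
by rewrite -(integralZl measurableT (iu p)).
Qed.

Let bilin_lin (P Q : finType) (A : P -> Q -> R) (u : P -> T -> R) (v : Q -> R)
    (x : T) :
  \sum_p \sum_q A p q * u p x * v q = \sum_p (\sum_q A p q * v q) * u p x.
Proof.
apply: eq_bigr => p _; rewrite big_distrl.
by apply: eq_bigr => q _; rewrite /= mulrAC.
Qed.

Lemma integrable_bilin (P Q : finType) (A : P -> Q -> R)
    (u : P -> T -> R) (v : Q -> R) :
  (forall p, mu.-integrable setT (EFin \o u p)) ->
  mu.-integrable setT (fun x => (\sum_p \sum_q A p q * u p x * v q)%:E).
Proof.
move=> iu; under eq_fun do rewrite bilin_lin.
exact: integrable_lincomb.
Qed.

Lemma inner_integral_bilin (P Q : finType) (A : P -> Q -> R)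
    (u : P -> T -> R) (v : Q -> R) :
  (forall p, mu.-integrable setT (EFin \o u p)) ->
  (\int[mu]_x (\sum_p \sum_q A p q * u p x * v q)%:E =
    (\sum_q (\sum_p A p q * \int[mu]_x u p x) * v q)%:E)%E.
Proof.
move=> iu; under eq_integral do rewrite bilin_lin.
rewrite integral_lincomb//; congr _%:E.
under [RHS]eq_bigr do rewrite big_distrl/=.
rewrite exchange_big; apply: eq_bigr => p _.
by rewrite big_distrl; apply: eq_bigr => q _; rewrite /= mulrAC.
Qed.

(** Linearity suffices: for fixed [y] the inner integral turns the sum into a linear combination of
    the [v q y], which is then integrated term by term. *)
Lemma iterated_integral_bilin (P Q : finType) (A : P -> Q -> R)
    (u : P -> T -> R) (v : Q -> T -> R) :
  (forall p, mu.-integrable setT (EFin \o u p)) ->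
  (forall q, mu.-integrable setT (EFin \o v q)) ->
  (\int[mu]_y \int[mu]_x (\sum_p \sum_q A p q * u p x * v q y)%:E =
    (\sum_p \sum_q A p q * (\int[mu]_x u p x) * (\int[mu]_y v q y))%:E)%E.
Proof.
move=> iu iv; under eq_integral do rewrite inner_integral_bilin//.
rewrite integral_lincomb//; congr _%:E; rewrite exchange_big/=.
by apply: eq_bigr => q _; rewrite big_distrl.
Qed.

(** For fixed [y] the majorant [C * F x * F y] is a multiple of [F]; the inner integrals are in turn
    dominated by [C] times the integral of [F] times [F y]. Measurability in [y] of the inner
    integral is assumed for each [k_ m]; for [k] it follows by pointwise limits. *)
Lemma iterated_dominated_convergence (k_ : nat -> T -> T -> R)
    (k : T -> T -> R) (F : T -> R) (C : R) :
  mu.-integrable setT (EFin \o F) ->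
  (forall m y, measurable_fun setT (k_ m ^~ y)) ->
  (forall m, measurable_fun setT (fun y => \int[mu]_x (k_ m x y)%:E : \bar R)%E) ->
  (forall x y, k_ m x y @[m --> \oo] --> k x y) ->
  (forall m x y, `|k_ m x y| <= C * F x * F y) ->
  [/\ forall y, mu.-integrable setT (fun x => (k x y)%:E),
      mu.-integrable setT (fun y => \int[mu]_x (k x y)%:E)%E &
      ((\int[mu]_y \int[mu]_x (k_ m x y)%:E) @[m --> \oo] -->
        \int[mu]_y \int[mu]_x (k x y)%:E)%E].
Proof.
move=> iF mk mJ kk kF.
have iG y : mu.-integrable setT (fun x => (C * F x * F y)%:E).
  apply: (@eq_integrable _ _ _ _ _ _ (fun x => (C * F y)%:E * (F x)%:E)%E) => //.
    by move=> x _; rewrite -EFinM mulrAC.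
  exact: (integrableZl measurableT _ iF).
have inner y : mu.-integrable setT (fun x => (k x y)%:E) /\
    ((\int[mu]_x (k_ m x y)%:E) @[m --> \oo] --> \int[mu]_x (k x y)%:E)%E.
  have [] := @dominated_convergence _ _ _ mu setT measurableT
    (fun m x => (k_ m x y)%:E) (fun x => (k x y)%:E)
    (fun x => (C * F x * F y)%:E) => //.
  - by move=> m; apply/measurable_EFinP; exact: mk.
  - apply/measurable_EFinP.
    exact: (@measurable_fun_cvg _ _ _ _ (fun m => k_ m ^~ y)).
  - by apply: aeW => x _; apply: cvg_EFin; [exact: nearW|exact: kk].
  - by apply: aeW => x m _; rewrite lee_fin.
have iH : mu.-integrable setT
    (fun y => (C * (\int[mu]_x F x) * F y)%:E).
  apply: (@eq_integrable _ _ _ _ _ _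
    (fun y => (C * (\int[mu]_x F x))%:E * (F y)%:E)%E) => //.
  exact: (integrableZl measurableT _ iF).
have [] := @dominated_convergence _ _ _ mu setT measurableT
    (fun m y => \int[mu]_x (k_ m x y)%:E)%E
    (fun y => \int[mu]_x (k x y)%:E)%E
    (fun y => (C * (\int[mu]_x F x) * F y)%:E) => //.
- apply: (@emeasurable_fun_cvg _ _ _ _ (fun m y => \int[mu]_x (k_ m x y)%:E)%E) => // y _.
  exact: (inner y).2.
- by apply: aeW => y _; exact: (inner y).2.
- apply: aeW => y m _.
  have mEk : measurable_fun setT (fun x => (k_ m x y)%:E).
    by apply/measurable_EFinP; exact: mk.
  apply: (le_trans (le_abse_integral mu measurableT mEk)).
  (* The outer majorant is written back as an inner integral, so that monotonicity of the integral
     reduces the bound to the pointwise one. *)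
  have -> : (C * (\int[mu]_x F x) * F y)%:E =
      (\int[mu]_x (C * F x * F y)%:E)%E.
    under eq_integral do rewrite mulrAC EFinM.
    rewrite (integralZl measurableT iF) mulrAC EFinM; congr (_ * _)%E.
    by rewrite /Rintegral fineK//; exact: integrable_fin_num iF.
  apply: ge0_le_integral => //.
  - exact: measurableT_comp.
  - exact: (measurable_int mu (iG y)).
  - by move=> x _; rewrite lee_fin.
- by move=> ? _ ?; split => // y; exact: (inner y).1.
Qed.

End iterated_integrals.

(** * Borel measurability and dense sequences in metric spaces *)

Section metric_borel.
Context {R : realType}.

Lemma continuous_borel_measurable (X : ptopologicalType) (f : X -> R) :
  continuous f -> measurable_fun [set: borelType X] f.
Proof.
move=> /continuousP cf; apply: (measurability _ (RGenOpens.measurableE R)).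
move=> _ [_ [a [b ->] <-]]; rewrite setTI; apply: sub_sigma_algebra.
exact/cf/interval_open.
Qed.

Lemma open_borel_measurable (X : ptopologicalType) (U : set X) :
  open U -> measurable (U : set (borelType X)).
Proof. exact: sub_sigma_algebra. Qed.

Lemma mdist_continuous (X : metricType R) (a : X) :
  continuous (mdist a : X -> R).
Proof.
move=> x; apply/cvgrPdist_lt => e e0.
near=> y; rewrite (@le_lt_trans _ _ (mdist x y))//.
  rewrite ler_norml lerBlDr lerBrDr.
  have := metric_triangle a x y; have := metric_triangle a y x.
  rewrite (metric_sym y x); lra.
by near: y; exact: (metricType_numDomainType.cvgr_dist_lt (@cvg_id _ (nbhs x))).
Unshelve. all: by end_near. Qed.

Lemma open_metric_ball (X : metricType R) (a : X) (r : R) :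
  open (ball a r).
Proof.
rewrite ballEmdist.
have /continuousP := @mdist_continuous X a.
by move=> /(_ [set t | t < r]); apply; exact: open_lt.
Qed.

Lemma separable_dense_seq (X : pmetricType R) :
  separable_space X -> exists s : nat -> X, dense (range s).
Proof.
(* A countable set is empty or the image of a sequence; a dense set is nonempty because [X] contains
   [point]. *)
move=> [D cD dD]; have [D0|[s]] := pfcard_geP cD.
  by have [||x []] := dD setT; [exists point|exact: openT|rewrite D0].
exists s => U U0 oU; have [x [Ux Dx]] := dD U U0 oU; exists x; split => //.
by have [n _ <-] := @surj _ _ _ _ s x Dx; exists n.
Qed.

End metric_borel.

(** * Measurable nearest-point approximation *)

Section nearest_index.
Context {R : realType} {X : pmetricType R}.
Variable s : nat -> X.

(** A running argmin of the distance from [x] to [s 0, ..., s m]. The recursion settles ties by the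
    earlier index and lets measurability be proved by induction on [m]. *)
Fixpoint nearest (m : nat) (x : X) : nat :=
  if m is m'.+1 then
    if mdist x (s m) < mdist x (s (nearest m' x)) then m else nearest m' x
  else 0.

Lemma nearest_le m x : (nearest m x <= m)%N.
Proof. by elim: m => //= m IH; case: ifP => // _; exact: leq_trans IH _. Qed.

Lemma mdist_nearest_le m k x : (k <= m)%N ->
  mdist x (s (nearest m x)) <= mdist x (s k).
Proof.
elim: m => [|m IH]; first by rewrite leqn0 => /eqP ->.
rewrite leq_eqVlt ltnS => /orP[/eqP -> /=|/IH /= km].
  by case: ltP.
by case: ltP => // /ltW /le_trans; apply.
Qed.

(** By density some [s k] is within [e] of [x], and for every [m >= k] the chosen point is at least
    as close as [s k]. *)
Lemma cvg_nearest x : dense (range s) -> s (nearest m x) @[m --> \oo] --> x.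
Proof.
move=> ds; apply/metricType_numDomainType.cvgrPdist_lt => e e0.
have [||y [/= xk [k _ sk]]] := ds (ball x e).
- by exists x; exact: ballxx.
- exact: open_metric_ball.
rewrite -sk ballEmdist /= in xk.
by exists k => // m /= km; exact: le_lt_trans (mdist_nearest_le x km) xk.
Qed.

(** The family [F] is arbitrary so that the induction hypothesis serves twice: for [F] itself, and
    for the distances [mdist x (s k)] that enter the comparison defining [nearest]. *)
Lemma measurable_nearest (F : nat -> X -> R) m :
  (forall k, measurable_fun [set: borelType X] (F k)) ->
  measurable_fun [set: borelType X] (fun x => F (nearest m x) x).
Proof.
elim: m F => [|m IH] F mF //=.
rewrite (_ : (fun x => _) = (fun x => if mdist x (s m.+1) <
    mdist x (s (nearest m x)) then F m.+1 x else F (nearest m x) x)); last first.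
  by apply/funext => x; case: ifP.
have md k : measurable_fun [set: borelType X] (fun x => mdist x (s k)).
  rewrite (_ : (fun x => _) = mdist (s k)); last first.
    by apply/funext => x; rewrite metric_sym.
  apply: (@continuous_borel_measurable _ X (mdist (s k))).
  exact: mdist_continuous.
apply: measurable_fun_ifT => //; last exact: IH.
apply: measurable_fun_ltr => //.
exact: (IH (fun k x => mdist x (s k))).
Qed.

End nearest_index.

(** * Continuous bumps supported in small balls *)

Section bump.
Context {R : realType} {X : pmetricType R}.
Variable mu : {measure set (borelType X) -> \bar R}.

Definition bump (a : X) (r : R) (x : X) : R := Num.max 0 (r - mdist a x).

Lemma bump_ge0 a r x : 0 <= bump a r x.
Proof. by rewrite /bump le_max lexx. Qed.

Lemma bump_neq0 a r x : bump a r x != 0 -> ball a r x.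
Proof.
rewrite ballEmdist/= ltNge; apply: contra_neqN; rewrite -subr_le0 => h.
exact/max_idPl.
Qed.

Lemma bump_continuous a r : continuous (bump a r).
Proof.
move=> x; apply: (@continuous_max R X (cst 0) (fun x => r - mdist a x)).
  exact: cst_continuous.
by apply: cvgB; [exact: cvg_cst|exact: mdist_continuous].
Qed.

Let measurable_ball a r : measurable (ball a r : set (borelType X)).
Proof. exact: (@open_borel_measurable X _ (open_metric_ball a r)). Qed.

Lemma integrable_bump a r : 0 < r -> (mu (ball a r) < +oo)%E ->
  mu.-integrable [set: borelType X] (EFin \o bump a r).
Proof.
move=> r0 fin.
have mb : measurable_fun [set: borelType X] (bump a r).
  exact: (@continuous_borel_measurable _ X _ (@bump_continuous a r)).
rewrite (_ : EFin \o _ = (EFin \o bump a r) \_ (ball a r)); last first.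
  apply/funext => x; rewrite patchE; case: ifPn => // /negP xr.
  congr _%:E; apply/eqP; apply: contra_notT xr => /bump_neq0 xr.
  exact: mem_set.
apply/(integrable_mkcond _ (measurable_ball a r)).
apply: measurable_bounded_integrable => //; first exact: measurable_funS mb.
exists r; split; first exact: num_real.
move=> M /ltW rM x _ /=; rewrite ger0_norm ?bump_ge0// (le_trans _ rM)//.
by rewrite ge_max (ltW r0)/= gerBl mdist_ge0.
Qed.

(** The bump is at least [r / 2] on the concentric ball of radius [r / 2], which has positive
    measure. *)
Lemma Rintegral_bump_gt0 a r : full_support mu -> 0 < r ->
  (mu (ball a r) < +oo)%E -> 0 < \int[mu]_x bump a r x.
Proof.
move=> fs r0 fin; have ib := integrable_bump r0 fin.
rewrite -lte_fin /Rintegral fineK; last exact: integrable_fin_num ib.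
pose B := ball a (r / 2) : set (borelType X).
have mB : measurable B by exact: measurable_ball.
have mI : measurable_fun setT (fun x => (\1_B x)%:E : \bar R).
  exact/measurable_EFinP/measurable_indic.
apply: (@lt_le_trans _ _ (\int[mu]_x ((r / 2)%:E * (\1_B x)%:E))%E).
  rewrite ge0_integralZl_EFin//; last by rewrite divr_ge0// ltW.
  rewrite integral_indic// setIT mule_gt0// ?lte_fin ?divr_gt0//.
  apply: fs; first exact: open_metric_ball.
  by exists a; apply: ballxx; rewrite divr_gt0.
apply: ge0_le_integral => //.
- by move=> x _; rewrite -EFinM lee_fin mulr_ge0// divr_ge0// ltW.
- exact: measurable_funeM.
- exact: measurable_int ib.
move=> x _; rewrite -EFinM lee_fin indicE.
have [xr|xr] := boolP (x \in B); last by rewrite mulr0 bump_ge0.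
move: xr; rewrite inE /B ballEmdist/= mulr1 /bump le_max => xr.
by apply/orP; right; lra.
Qed.

End bump.

(** * Discretising the double integral of a kernel *)

Section kernel_integrals.
Context {R : realType} {X : pmetricType R} {N : nat}.
Variable mu : {measure set (borelType X) -> \bar R}.
Variable K : X -> X -> 'M[R]_N.

Lemma continuous_bilinear_form (u v : 'cV[R]_N) : continuous_kernel K ->
  continuous (fun z : X * X => bilinear_form (K z.1 z.2) u v : R).
Proof.
move=> cK; under eq_fun do rewrite bilinear_formE.
apply: continuous_big => [|a _]; first exact: add_continuous.
apply: continuous_big => [|b _]; first exact: add_continuous.
move=> z; apply: cvgM; last exact: cvg_cst.
apply: cvgM; last exact: cvg_cst.
apply: (@continuous_comp _ _ _ (fun z : X * X => K z.1 z.2)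
  (fun M : 'M[R]_N => M a b)); first exact: cK.
exact: coord_continuous.
Qed.

Let sum_pair (I J : finType) (F : I * J -> R) :
  \sum_p F p = \sum_i \sum_j F (i, j).
Proof. by rewrite pair_bigA; apply: eq_bigr => -[]. Qed.

Hypotheses (bK : bounded_kernel K) (cK : continuous_kernel K).
Variable s : nat -> X.
Variable f : X -> 'cV[R]_N.
Hypothesis L1f : L1 mu N f.

(** For [p = (k, a)]: the coordinate [a] of [f], cut off to the cell of points whose nearest index
    is [k]. Cell and coordinate form one index, so that the lemmas on separated sums apply with the
    coefficients [K_]. *)
Let u m (p : 'I_m.+1 * 'I_N) (x : X) : R :=
  (nearest s m x == p.1)%:R * f x p.2 ord0.

Let integrable_u m p : mu.-integrable [set: borelType X] (EFin \o @u m p).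
Proof.
apply: le_integrable (L1f p.2) => //.
  apply/measurable_EFinP.
  apply: (@measurable_nearest _ _ s (fun k x => (k == p.1)%:R * f x p.2 ord0)).
  move=> k; apply: measurable_funM => //.
  by apply/measurable_EFinP; exact: measurable_int (L1f p.2).
move=> x _; rewrite lee_fin normrM /u.
by case: eqP => _; rewrite ?normr1 ?mul1r// normr0 mul0r.
Qed.

Let K_ m (p q : 'I_m.+1 * 'I_N) : R := K (s p.1) (s q.1) p.2 q.2.

(** Cutting off to cells collapses each sum over pairs to the one cell containing [x], respectively
    [y], leaving the sum over coordinates. *)
Let bilinear_form_nearest m x y :
  bilinear_form (K (s (nearest s m x)) (s (nearest s m y))) (f x) (f y) =
  \sum_p \sum_q @K_ m p q * u p x * u q y.
Proof.
have nm z : (nearest s m z < m.+1)%N by rewrite ltnS nearest_le.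
have sum_u z (g : 'I_m.+1 * 'I_N -> R) :
    \sum_p g p * u p z = \sum_a g (Ordinal (nm z), a) * f z a ord0.
  rewrite sum_pair (bigD1 (Ordinal (nm z)))//= [X in _ + X]big1 ?addr0.
    by apply: eq_bigr => a _; rewrite /u/= eqxx mul1r.
  move=> k kz; rewrite big1// => a _; rewrite /u/=.
  by rewrite eq_sym (negbTE (_ : val k != _)) ?mul0r ?mulr0.
rewrite bilinear_formE.
under [RHS]eq_bigr do under eq_bigr do rewrite mulrAC.
under [RHS]eq_bigr do rewrite -big_distrl/= sum_u.
rewrite sum_u; apply: eq_bigr => a _; rewrite big_distrl/=.
by apply: eq_bigr => b _; rewrite mulrAC.
Qed.

(** The limit serves to go from sums to integrals; the two integrability claims serve in the
    converse direction, to compare iterated integrals. *)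
Lemma iterated_integral_nearest : dense (range s) ->
  [/\ forall y, mu.-integrable [set: borelType X]
        (fun x => (bilinear_form (K x y) (f x) (f y))%:E),
      mu.-integrable [set: borelType X]
        (fun y => \int[mu]_x (bilinear_form (K x y) (f x) (f y))%:E)%E &
      ((\int[mu]_y \int[mu]_x
          (bilinear_form (K (s (nearest s m x)) (s (nearest s m y)))
             (f x) (f y))%:E) @[m --> \oo] -->
        \int[mu]_y \int[mu]_x (bilinear_form (K x y) (f x) (f y))%:E)%E].
Proof.
move=> ds; have [C KC] := bK.
apply: (@iterated_dominated_convergence _ (borelType X) R mu
  (fun m x y => bilinear_form (K (s (nearest s m x)) (s (nearest s m y)))
     (f x) (f y))
  (fun x y => bilinear_form (K x y) (f x) (f y))
  (fun x => \sum_a `|f x a ord0|) C).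
- apply: (@eq_integrable _ _ _ _ _ _
    (fun x : borelType X => \sum_a `|(f x a ord0)%:E| : \bar R)%E) => //.
    by move=> x _ /=; rewrite -sumEFin.
  apply: integrable_sum => // a _.
  exact: (integrable_abse (L1f a)).
- move=> m y; under eq_fun do rewrite bilinear_form_nearest.
  apply: measurable_sum => p; apply: measurable_sum => q.
  apply: measurable_funM => //; apply: measurable_funM => //.
  by apply/measurable_EFinP; exact: measurable_int (integrable_u p).
(* For the discretised kernel the inner integral is an explicit linear combination of the integrable
   functions [u q], hence measurable in [y]. *)
- move=> m; under eq_fun do under eq_integral do rewrite bilinear_form_nearest.
  under eq_fun do rewrite inner_integral_bilin//.
  exact: measurable_int (integrable_lincomb _ (@integrable_u m)).
- move=> x y.
  have sxy : (s (nearest s m x), s (nearest s m y)) @[m --> \oo] --> (x, y).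
    by apply: cvg_pair; exact: cvg_nearest.
  exact: (cvg_comp _ _ sxy (@continuous_bilinear_form (f x) (f y) cK (x, y))).
- move=> m x y; apply: le_bilinear_form; apply: KC.
  by exists (s (nearest s m x), s (nearest s m y)).
Qed.

Lemma iterated_integral_nearest_ge0 m : positive_definite K ->
  (0 <= \int[mu]_y \int[mu]_x
          (bilinear_form (K (s (nearest s m x)) (s (nearest s m y)))
             (f x) (f y))%:E)%E.
Proof.
move=> pK; under eq_integral do under eq_integral do rewrite bilinear_form_nearest.
rewrite iterated_integral_bilin// lee_fin.
(* The vector attached to [s k] is the integral of [f] over the cell of index [k]. *)
have := pK m.+1 (fun k => s k) (fun k => \col_a \int[mu]_x u (k, a) x) isT.
congr (0 <= _).
rewrite [RHS]sum_pair; apply: eq_bigr => k _.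
under eq_bigr do rewrite bilinear_formE.
rewrite exchange_big; apply: eq_bigr => a _.
by rewrite [RHS]sum_pair; apply: eq_bigr => l _; apply: eq_bigr => b _; rewrite !mxE.
Qed.

End kernel_integrals.

(** * The implications between sums and integrals, and the equivalence *)

Lemma positive_definite_integrally (R : realType) (X : pmetricType R)
    (mu : {measure set (borelType X) -> \bar R}) (N : nat)
    (K : X -> X -> 'M[R]_N) :
  separable_space X -> bounded_kernel K -> continuous_kernel K ->
  positive_definite K -> integrally_positive_definite mu K (L1 mu N).
Proof.
move=> /separable_dense_seq[s ds] bK cK pK f L1f.
have [_ _ kcvg] := iterated_integral_nearest bK cK L1f ds.
apply: cvge_ge kcvg.
by apply: nearW => m; exact: (iterated_integral_nearest_ge0 s L1f m pK).
Qed.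

(** For bumps of small radius and mass 1, the double integral exceeds the discrete sum by at most an
    arbitrary [e' > 0]; being nonnegative, it forces the sum to be at least [-e']. *)
Lemma integrally_positive_definite_discrete (R : realType) (X : pmetricType R)
    (mu : {measure set (borelType X) -> \bar R}) (N : nat)
    (K : X -> X -> 'M[R]_N) :
  separable_space X -> locally_finite mu -> full_support mu ->
  bounded_kernel K -> continuous_kernel K ->
  integrally_positive_definite mu K
    ([set f : X -> 'cV[R]_N | continuous f] `&` L1 mu N) ->
  positive_definite K.
Proof.
move=> /separable_dense_seq[s ds] lf fs bK cK ipK n x c n0.
pose B i j y z := bilinear_form (K y z) (c i) (c j).
apply/ler_addgt0Pr => e' e'0.
(* Each of the [n * n] pairs [(i, j)] will contribute an error [e]. *)
pose e := e' / (n * n)%:R.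
have e0 : 0 < e by rewrite divr_gt0// ltr0n muln_gt0 n0.
(* Conditions holding for all small [r > 0] can be imposed for finitely many indices at once, which
   yields a common radius. *)
have nfin : \forall r \near 0^'+, forall i, (mu (ball (x i) r) < +oo)%E.
  apply: filter_forall => i; have [U oU Ufin] := lf (x i).
  have /nbhs_ballP[d /= d0 dU] := open_nbhs_nbhs oU.
  near=> r; apply: le_lt_trans Ufin; apply: le_measure.
  - by rewrite inE; exact: (@open_borel_measurable X _ (open_metric_ball _ _)).
  - by rewrite inE; exact: (@open_borel_measurable X _ oU.1).
  - apply: subset_trans dU; apply: le_ball.
    by near: r; exact: nbhs_right_le.
have nsmall : \forall r \near 0^'+, forall p : 'I_n * 'I_n, forall y z,
    ball (x p.1) r y -> ball (x p.2) r z ->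
    B p.1 p.2 y z <= B p.1 p.2 (x p.1) (x p.2) + e.
  apply: filter_forall => -[i j] /=.
  have := @continuous_bilinear_form R X N K (c i) (c j) cK (x i, x j).
  move=> /cvgrPdist_le/(_ e e0)/nbhs_ballP[d /= d0 dB].
  near=> r => y z ry rz.
  have rd : r <= d by near: r; exact: nbhs_right_le.
  have /= := dB (y, z) (conj (le_ball rd ry) (le_ball rd rz)).
  by rewrite ler_norml /B => /andP[h _]; lra.
have [r [[r0 fin] small']] := filter_ex (filterI (filterI (nbhs_right_gt 0) nfin) nsmall).
have small i j := small' (i, j).
pose a i := \int[mu]_y bump (x i) r y.
have a0 i : 0 < a i by exact: Rintegral_bump_gt0.
pose psi i y := (a i)^-1 * bump (x i) r y.
have psi_ge0 i y : 0 <= psi i y by rewrite mulr_ge0 ?invr_ge0 ?bump_ge0// ltW.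
have ipsi i : mu.-integrable [set: borelType X] (EFin \o psi i).
  exact: (integrableZl measurableT (a i)^-1 (integrable_bump r0 (fin i))).
have int_psi i : \int[mu]_y psi i y = 1.
  rewrite RintegralZl//; last exact: integrable_bump.
  by rewrite mulVf// gt_eqF.
pose f y := \sum_i psi i y *: c i.
have cf : continuous f.
  apply: continuous_big => [|i _]; first exact: add_continuous.
  move=> y; apply: cvgZr_tmp; apply: cvgM; first exact: cvg_cst.
  exact: bump_continuous.
have L1f : L1 mu N f.
  move=> b; apply: (@eq_integrable _ _ _ _ _ _
      (EFin \o (fun y : borelType X => \sum_i c i b ord0 * psi i y))) => //.
    move=> y _; rewrite /f/= summxE; congr _%:E; apply: eq_bigr => i _.
    by rewrite mxE mulrC.
  exact: integrable_lincomb.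
have fKf y z : bilinear_form (K y z) (f y) (f z) =
    \sum_i \sum_j B i j y z * psi i y * psi j z.
  exact: bilinear_form_sum.
have le_fKf y z : bilinear_form (K y z) (f y) (f z) <=
    \sum_i \sum_j (B i j (x i) (x j) + e) * psi i y * psi j z.
  rewrite fKf; apply: ler_sum => i _; apply: ler_sum => j _.
  (* If either bump vanishes, both terms are 0; otherwise [y] and [z] lie in the two balls, and the
     upper bound on [B] survives multiplication by the nonnegative weights. *)
  have [b0|/bump_neq0 iy] := eqVneq (bump (x i) r y) 0.
    by rewrite /psi b0 mulr0 !mulr0 !mul0r.
  have [b0|/bump_neq0 jz] := eqVneq (bump (x j) r z) 0.
    by rewrite /psi b0 !mulr0.
  by rewrite ler_wpM2r// ler_wpM2r// small.
(* Monotonicity of the integral for functions of varying sign needs integrability at both levels,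
   obtained here for this [f]. *)
have [ik iJ _] := iterated_integral_nearest bK cK L1f ds.
have := ipK f (conj cf L1f).
have : (\int[mu]_z \int[mu]_y (bilinear_form (K y z) (f y) (f z))%:E <=
   \int[mu]_z \int[mu]_y
     (\sum_i \sum_j (B i j (x i) (x j) + e) * psi i y * psi j z)%:E)%E.
  apply: le_integral => //.
    under eq_fun do rewrite inner_integral_bilin//.
    exact: integrable_lincomb.
  move=> z _; apply: le_integral => //; last by move=> y _; rewrite lee_fin.
  exact: integrable_bilin.
rewrite iterated_integral_bilin// => /[swap] /le_trans /[apply].
rewrite lee_fin.
(* With all masses equal to 1, the bound is the discrete sum plus [n * n] copies of [e], that is,
   plus [e']. *)
under eq_bigr do under eq_bigr do rewrite !int_psi !mulr1.
under eq_bigr do rewrite big_split/= sumr_const card_ord.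
rewrite big_split/= sumr_const card_ord -mulrnA.
rewrite -[e *+ _]mulr_natr /e divfK//.
by rewrite pnatr_eq0 -lt0n muln_gt0 n0.
Unshelve. all: by end_near.
Qed.

Theorem theorem1p2 (R : realType) (X : pmetricType R)
    (mu : {measure set (borelType X) -> \bar R}) (N : nat)
    (K : X -> X -> 'M[R]_N) :
  separable_space X ->
  locally_finite mu ->
  full_support mu ->
  (0 < N)%N ->
  bounded_kernel K ->
  continuous_kernel K ->
  (forall x y : X, K x y = (K y x)^T) ->
  (positive_definite K <->
     integrally_positive_definite mu K
       ([set f : X -> 'cV[R]_N | continuous f] `&` L1 mu N)) /\
  (integrally_positive_definite mu K
       ([set f : X -> 'cV[R]_N | continuous f] `&` L1 mu N) <->
     integrally_positive_definite mu K (L1 mu N)).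
Proof.
move=> sX lf fs _ bK cK _.
have i_iii := positive_definite_integrally sX bK cK.
have ii_i := integrally_positive_definite_discrete sX lf fs bK cK.
have iii_ii : integrally_positive_definite mu K (L1 mu N) ->
    integrally_positive_definite mu K
      ([set f : X -> 'cV[R]_N | continuous f] `&` L1 mu N).
  by move=> ipK f [_ L1f]; exact: ipK.
split; first by split=> [/i_iii/iii_ii|/ii_i].
by split=> [/ii_i/i_iii|/iii_ii].
Qed.
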